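(* Let $(X,d)$ be a $Q$-ary distance-regular space of dimension $N\ge 2$ over $\mathbb{F}_Q$ with weight $\omega$. Let $k$ and $d$ be integers with $1\le k\le N$ and $1\le d\le|\omega|$. Let $\mathcal{F}$ be a (non-empty) $\mathcal{P}(\omega)$-balanced family of $\mathbb{F}_Q$-linear codes in $X$ of dimension $k$ and minimum distance $d$. Assume that all codes in $\mathcal{F}$ have the same weight distribution, say $(W_i(\mathcal{F})\mid i\in\mathbb{N})$. For all $x\in X$ we have $$\overline{\delta_x}(\mathcal{F})=Q^{-k}\left(\omega(x)+\sum_{i=d}^{|\omega|}\frac{W_i(\mathcal{F})}{W_i(X)}\sum_{j=0}^{|\omega|}j\cdot\boldsymbol{p}(\omega(x);i,j)\right).$$
   Context: Let $Q$ be a prime power, $X$ a finite-dimensional $\mathbb{F}_Q$-vector space and $d:X\times X\to\mathbb{N}$ an integer-valued distance function (the letter $d$ is also used for the integer minimum distance). $(X,d)$ is a $Q$-ary distance-regular space if: (1) $d(\alpha x,\alpha y)=d(x,y)$ for all $x,y\in X$, $\alpha\in\mathbb{F}_Q\setminus\{0\}$; (2) $d(x,y)=d(0,x-y)$ for all $x,y\in X$; (3) for all $x,y\in X$ and $j,k\in\mathbb{N}$, $|\{z\in X\mid d(z,x)=j,\ d(z,y)=k\}|$ depends only on $d(x,y)$ (and $j,k$); (4) with $\omega(x):=d(x,0)$ the weight, $|\omega|:=\max\{\omega(x)\mid x\in X\}=|\omega(X)|-1$, i.e. every integer in $\{0,\dots,|\omega|\}$ is the weight of some vector. The intersection numbers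 are $\boldsymbol{p}(i;j,k):=|\{z\in X\mid d(z,x)=j,\ d(z,y)=k\}|$ for any $x,y\in X$ with $d(x,y)=i$. For a code $\mathcal{C}\subseteq X$, $W_i(\mathcal{C}):=|\{x\in\mathcal{C}\mid\omega(x)=i\}|$, and the sequence $(W_i(\mathcal{C}) \mid i\in\mathbb{N})$ is its weight distribution. The minimum distance of a code with at least two elements is the minimum of the distance over pairs of distinct codewords. The weight partition $\mathcal{P}(\omega)$ of $X$ has classes $\mathcal{P}_i(\omega)=\{x\in X\mid\omega(x)=i\}$, $0\le i\le|\omega|$. A non-empty family $\mathcal{F}$ of codes in $X$ is $\mathcal{P}(\omega)$-balanced if the number of codes $\mathcal{C}\in\mathcal{F}$ containing $x\in X$ depends only on the class of $x$, i.e. only on $\omega(x)$. For a non-empty code $\mathcal{C}\subseteq X$ and $x\in X$, $\delta_x(\mathcal{C}):=|\mathcal{C}|^{-1}\sum_{y\in\mathcal{C}}d(x,y)$, and $\overline{\delta_x}(\mathcal{F}):=|\mathcal{F}|^{-1}\sum_{\mathcal{C}\in\mathcal{F}}\delta_x(\mathcal{C})$. *)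

(* Defs.v *)
From HB Require Import structures.
From mathcomp Require Import all_boot all_order all_algebra all_field.

Set Implicit Arguments.
Unset Strict Implicit.
Unset Printing Implicit Defensive.

Import GRing.Theory Num.Theory.

Local Open Scope ring_scope.

(* [finvect_type X] is [X] itself, equipped with the finType structure it gets
   from being a finite-dimensional vector space over a finite field. *)

Section DistanceRegular.

Variables (F : finFieldType) (X : vectType F).
Implicit Types (dist : X -> X -> nat) (C : {set finvect_type X}).

Definition distance_function dist : Prop :=
  [/\ forall x y, dist x y = 0%N <-> x = y,
      forall x y, dist x y = dist y x
    & forall x y z, (dist x z <= dist x y + dist y z)%N].

Definition weight dist (x : X) : nat := dist x 0.

Definition max_weight dist : nat := \max_(x : finvect_type X) weight dist x.

Definition sphere_inter dist (x y : X) (j k : nat) : {set finvect_type X} :=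
  [set z : finvect_type X | (dist z x == j) && (dist z y == k)].

Record distance_regular dist : Prop := DistanceRegular {
  dr_distance : distance_function dist;
  dr_scale : forall (a : F) (x y : X), a != 0 -> dist (a *: x) (a *: y) = dist x y;
  dr_translate : forall x y : X, dist x y = dist 0 (x - y);
  dr_regular : forall (x y x' y' : X) (j k : nat), dist x y = dist x' y' ->
    #|sphere_inter dist x y j k| = #|sphere_inter dist x' y' j k|;
  dr_weights : forall i : nat, (i <= max_weight dist)%N ->
    exists x : X, weight dist x = i
}.

(* By [dr_regular] the pair picked is irrelevant; the value is 0 when no two
   vectors are at distance [i]. *)
Definition intersection_number dist (i j k : nat) : nat :=
  if [pick u : finvect_type X * finvect_type X | dist u.1 u.2 == i] is Some u
  then #|sphere_inter dist u.1 u.2 j k| else 0%N.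

Definition weight_count dist (i : nat) C : nat :=
  #|[set x in C | weight dist x == i]|.

Definition min_distance dist C (m : nat) : Prop :=
  (exists x y, [/\ x \in C, y \in C, x != y & dist x y = m]) /\
  (forall x y, x \in C -> y \in C -> x != y -> (m <= dist x y)%N).

Definition linear_code C (k : nat) : Prop :=
  exists2 V : {vspace X}, C = [set x : finvect_type X | (x : X) \in V]
                        & \dim V = k.

Definition weight_balanced dist (Fam : {set {set finvect_type X}}) : Prop :=
  Fam != set0 /\
  forall x y : finvect_type X, weight dist x = weight dist y ->
    #|[set C in Fam | x \in C]| = #|[set C in Fam | y \in C]|.

Definition average_distance dist (x : X) C : rat :=
  (#|C|%:R)^-1 * \sum_(y in C) (dist x y)%:R.

Definition family_average_distance dist (x : X)
    (Fam : {set {set finvect_type X}}) : rat :=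
  (#|Fam|%:R)^-1 * \sum_(C in Fam) average_distance dist x C.

End DistanceRegular.

(* Main.v *)
(* Double counting turns the sum over codes and codewords into a sum over
   y in X of dist x y, weighted by the number of codes containing y.  Balance
   makes this number constant on each sphere of weight i, hence equal to
   #|Fam| * W i / W_i(X), while distance-regularity evaluates the sum of
   dist x y over that sphere through the intersection numbers.  The sphere of
   weight 0 contributes the term weight x, and those of weight strictly between
   0 and d contain no codeword. *)
Require Import Defs.
From HB Require Import structures.
From mathcomp Require Import all_boot all_order all_algebra all_field.

Set Implicit Arguments.
Unset Strict Implicit.
Unset Printing Implicit Defensive.

Import GRing.Theory Num.Theory.

Local Open Scope ring_scope.

Lemma sum_by_value (R : nmodType) (T : finType) (P : pred T) (h : T -> nat)
    (n : nat) (f : T -> R) :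
  (forall y, h y < n)%N ->
  \sum_(y | P y) f y = \sum_(0 <= i < n) \sum_(y | P y && (h y == i)) f y.
Proof.
move=> h_lt; rewrite big_mkord.
exact: (partition_big (fun y => Ordinal (h_lt y)) predT).
Qed.

Section DistanceRegularTheory.

Variables (F : finFieldType) (X : vectType F) (dist : X -> X -> nat).
Hypothesis hdist : distance_regular dist.

Local Notation V := (finvect_type X).
Local Notation M := (max_weight dist).

Lemma distC (x y : X) : dist x y = dist y x.
Proof. by have [[_ + _] _ _ _ _] := hdist; apply. Qed.

Lemma weight_eq0 (x : X) : (weight dist x == 0%N) = (x == 0).
Proof. by have [[dist0 _ _] _ _ _ _] := hdist; apply/eqP/eqP => /dist0. Qed.

Lemma weight_lt (x : X) : (weight dist x < M.+1)%N.
Proof. by rewrite ltnS; exact: (leq_bigmax (x : V)). Qed.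

Lemma dist_lt (x y : X) : (dist x y < M.+1)%N.
Proof.
by have [_ _ -> _ _] := hdist; rewrite distC; apply: weight_lt.
Qed.

(** The pair [(x, y)] itself shows that [pick] succeeds, so the default 0 is not reached; regularity
    then replaces the picked pair by [(x, y)]. *)
Lemma intersection_numberE (x y : X) (j k : nat) :
  intersection_number dist (dist x y) j k = #|sphere_inter dist x y j k|.
Proof.
have [_ _ _ reg _] := hdist; rewrite /intersection_number.
case: pickP => [u /eqP/reg -> // | /(_ (x : V, y : V))].
by rewrite /= eqxx.
Qed.

(** Slice the sphere by the value [j] of [dist x y]: each slice is the intersection of a sphere
    about 0 with one about [x]. *)
Lemma sum_dist_sphere (R : pzSemiRingType) (x : X) (i : nat) :
  \sum_(y : V | weight dist y == i) (dist x y)%:R =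
  \sum_(0 <= j < M.+1)
    j%:R * (intersection_number dist (weight dist x) i j)%:R :> R.
Proof.
rewrite (@sum_by_value _ V _ (dist x) M.+1); last exact: dist_lt.
apply: eq_bigr => j _.
(* Turning [dist x 0] into [dist 0 x] puts the centre 0 first, so that [i] is the distance to 0 and
   [j] the distance to [x]. *)
rewrite /weight distC intersection_numberE mulr_natr.
rewrite (eq_bigr (fun=> j%:R)) => [|y /andP[_ /eqP->] //].
rewrite sumr_const; congr (_ *+ _); apply: eq_card => y.
by rewrite !inE -[in RHS](distC x).
Qed.

Lemma sum_dist_weight0 (R : pzSemiRingType) (x : X) :
  \sum_(y : V | weight dist y == 0%N) (dist x y)%:R = (weight dist x)%:R :> R.
Proof. by rewrite (big_pred1 (0 : V)) // => y; rewrite weight_eq0. Qed.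

(** A codeword of weight [i > 0] would be a codeword other than 0 at distance [i < d] from the
    codeword 0. *)
Lemma weight_count_small (C : {set V}) (d i : nat) :
  (0 : V) \in C -> min_distance dist C d -> (0 < i < d)%N ->
  weight_count dist i C = 0%N.
Proof.
move=> C0 [_ Cmin] /andP[i_gt0 i_lt]; apply: eq_card0 => y; rewrite !inE.
apply/negP => /andP[Cy /eqP wy]; have y0 : y != 0.
  by rewrite -weight_eq0 wy -lt0n.
by have := Cmin _ _ Cy C0 y0; rewrite leqNgt -/(weight dist y) wy i_lt.
Qed.

(** Count the pairs [(z, C)] with [z] in [C] of the same weight as [y]. By [z], balance gives each
    the multiplicity of [y]; by [C], each code contributes the same [W] value. *)
Lemma card_balanced (Fam : {set {set V}}) (W : nat -> nat) (y : V) :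
  weight_balanced dist Fam ->
  (forall C, C \in Fam -> forall i, weight_count dist i C = W i) ->
  #|[set C in Fam | y \in C]|%:R =
    #|Fam|%:R * ((W (weight dist y))%:R /
      (weight_count dist (weight dist y) [set: V])%:R) :> rat.
Proof.
move=> [_ bal] hW; set i := weight dist y.
(* The denominator is nonzero because [y] lies in its own sphere. *)
have count_neq0 : (weight_count dist i [set: V])%:R != 0 :> rat.
  rewrite pnatr_eq0 -lt0n; apply/card_gt0P; exists y.
  by rewrite !inE eqxx.
rewrite mulrA; apply: (canRL (mulfK count_neq0)); rewrite -!natrM.
congr _%:R.
transitivity (\sum_(z : V | weight dist z == i) #|[set C in Fam | z \in C]|)%N.
  rewrite mulnC -sum_nat_const.
  by apply: eq_big => [z|z]; rewrite !inE // => /eqP/bal->.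
transitivity (\sum_(C in Fam) weight_count dist i C)%N; last first.
  by rewrite -sum_nat_const; apply: eq_bigr => C /hW->.
rewrite (eq_bigr (fun z => \sum_(C in Fam | z \in C) 1)%N); last first.
  by move=> z _; rewrite sum1dep_card.
rewrite (exchange_big_dep (mem Fam)) /= => [|z C _ /andP[]//].
apply: eq_bigr => C FC; rewrite sum1_card; apply: eq_card => z.
by rewrite unfold_in /= !inE FC andbC.
Qed.

End DistanceRegularTheory.

Lemma card_linear_code (F : finFieldType) (X : vectType F)
    (C : {set finvect_type X}) (k : nat) :
  linear_code C k -> #|C| = (#|F| ^ k)%N.
Proof.
(* [card_vspace] takes a finite type and a vector space class on it separately; opening [X] exposes
   the class [cT]. *)
case: X C => T cT C [V -> <-].
rewrite -(@card_vspace F (finvect_type (Vector.Pack cT)) cT V).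
by apply: eq_card => y; rewrite inE.
Qed.

Lemma linear_code0 (F : finFieldType) (X : vectType F)
    (C : {set finvect_type X}) (k : nat) :
  linear_code C k -> (0 : finvect_type X) \in C.
Proof. by move=> [V -> _]; rewrite inE mem0v. Qed.

Theorem theorem9p8 (F : finFieldType) (X : vectType F) (dist : X -> X -> nat)
  (N k d : nat) (Fam : {set {set finvect_type X}}) (W : nat -> nat)
  (hdist : distance_regular dist)
  (hdim : \dim {:X} = N) (hN : (2 <= N)%N)
  (hk : (1 <= k <= N)%N) (hd : (1 <= d <= max_weight dist)%N)
  (hbal : weight_balanced dist Fam)
  (hlin : forall C, C \in Fam -> linear_code C k)
  (hmin : forall C, C \in Fam -> min_distance dist C d)
  (hW : forall C, C \in Fam -> forall i, weight_count dist i C = W i)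
  (x : X) :
  family_average_distance dist x Fam =
    (#|F|%:R ^+ k)^-1 *
    ((weight dist x)%:R +
     \sum_(d <= i < (max_weight dist).+1)
       (W i)%:R / (weight_count dist i [set: finvect_type X])%:R *
       \sum_(0 <= j < (max_weight dist).+1)
         j%:R * (intersection_number dist (weight dist x) i j)%:R).
Proof.
have [Fam_neq0 _] := hbal; have [C0 FC0] := set0Pn _ Fam_neq0.
have Fam_card : #|Fam|%:R != 0 :> rat by rewrite pnatr_eq0 cards_eq0.
have W_small i : (0 < i < d)%N -> W i = 0%N.
  rewrite -(hW _ FC0).
  exact: weight_count_small (linear_code0 (hlin _ FC0)) (hmin _ FC0).
rewrite /family_average_distance /average_distance.
(* All codes have the same size, so the inverse of [#|F| ^ k] factors out of the sum over the
   family. *)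
under eq_bigr => C FC do rewrite (card_linear_code (hlin _ FC)) natrX.
rewrite -mulr_sumr mulrCA; congr (_ * _).
apply: (canLR (mulKf Fam_card)).
rewrite (exchange_big_dep predT) //=.
(* After the exchange each [y] counts once per code containing it; [card_balanced] supplies this
   multiplicity. *)
transitivity (\sum_(y : finvect_type X) #|Fam|%:R *
    ((dist x y)%:R * ((W (weight dist y))%:R /
      (weight_count dist (weight dist y) [set: finvect_type X])%:R)) : rat).
  apply: eq_bigr => y _.
  rewrite mulrCA -(card_balanced y hbal hW) sumr_const mulr_natr.
  by congr (_ *+ _); apply: eq_card => C; rewrite !inE.
rewrite -mulr_sumr; congr (_ * _).
rewrite (@sum_by_value _ (finvect_type X) _ (weight dist) (max_weight dist).+1);
  last exact: weight_lt.
have [d_gt0 d_le] := andP hd.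
rewrite (big_cat_nat (n := d)) //=; last exact: leqW.
(* Since [d > 0], the range below [d] splits into the term 0, which is kept, and the weights from 1
   to [d - 1], where [W] vanishes. *)
rewrite big_ltn // [X in _ + X + _]big1_seq ?addr0; last first.
  move=> i; rewrite mem_index_iota => /W_small Wi; apply: big1 => y /eqP->.
  by rewrite Wi mul0r mulr0.
congr (_ + _); last first.
  apply: eq_bigr => i _; rewrite -(sum_dist_sphere hdist) mulr_sumr.
  by apply: eq_bigr => y /eqP->; rewrite mulrC.
rewrite -(sum_dist_weight0 hdist); apply: eq_bigr => y /eqP wy.
have y0 : y = 0 by apply/eqP; rewrite -(weight_eq0 hdist) wy.
have := card_balanced y hbal hW; rewrite wy y0.
(* Every linear code contains 0, so [card_balanced] at [y = 0] equates [#|Fam|] with [#|Fam|] times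
   the ratio for weight 0, which is therefore 1. *)
rewrite (_ : [set C in Fam | 0 \in C] = Fam); last first.
  apply/setP => C; rewrite inE andb_idr // => /hlin; exact: linear_code0.
by move/(canLR (mulKf Fam_card)); rewrite mulVf // => <-; rewrite mulr1.
Qed.
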